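(* Consider the attitude estimation algorithm described in the context. At each measurement, let $P_0$ denote the uncertainty matrix of the filtered estimate at the previous measurement instant, $A^f$ the linear discrete flow matrix from the previous to the current measurement instant, $P^f=A^fP_0(A^f)^{T}$ the flow-predicted uncertainty matrix, $P^m$ the measured uncertainty matrix, $q>0$ the filter parameter, and $P$ the new filtered uncertainty matrix. Let $\Lambda=\mathrm{diag}[\lambda_i]$, $i=1,\dots,6$, be the matrix of real positive eigenvalues of $(P^m)^{-1}P^f$ and let $\lambda_{\min}$ be the smallest of the $\lambda_i$. The estimation algorithm is convergent, i.e. the size $\mathrm{tr}[P]$ of the uncertainty matrix decreases monotonically with measurements, if there exists a constant $c\in(0,1)$ such that for every measurement $$\|A^f\|<\sqrt{\frac{c\,(q+\lambda_{\min})}{6\,\chi(P^m)\,(1+q)}},$$ where $\|\cdot\|$ denotes the Frobenius norm, $\chi(P^m)=\sqrt{6+30\,\kappa(P^m)}$, and $\kappa(P^m)$ is the condition number of $P^m$ (ratio of its largest to its smallest eigenvalue).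
   Context: **Notation.** $S:\mathbb{R}^3\to\mathfrak{so}(3)$ is defined by $S(x)y=x\times y$. Uncertainty matrices ($P_0,P^f,P^m,P$) are symmetric positive definite $6\times6$ matrices; the size of an uncertainty matrix is its trace. An uncertainty matrix $P$ centered at $(\hat C,\hat\omega)\in SO(3)\times\mathbb{R}^3$ describes the set of states $(\hat C\exp(S(\zeta)),\hat\omega+\delta\omega)$ with $x=[\zeta^{T},\delta\omega^{T}]^{T}\in\mathbb{R}^6$, $x^{T}P^{-1}x\le1$. **Dynamics.** $J\in\mathbb{R}^{3\times3}$ is the moment of inertia matrix, $J_d=\frac12\mathrm{tr}[J]I_{3\times3}-J$, $h>0$ is the step size, $U:SO(3)\to\mathbb{R}$ is the potential, and $M=M(C)\in\mathbb{R}^3$ is defined by $S(M)=\left(\frac{\partial U}{\partial C}\right)^{T}C-C^{T}\frac{\partial U}{\partial C}$. The discrete flow $(C_k,\omega_k)\mapsto(C_{k+1},\omega_{k+1})$ is $hS(J\omega_k+\frac h2M_k)=F_kJ_d-J_dF_k^{T}$ (solved for $F_k=\exp(S(f_k))\in SO(3)$), $C_{k+1}=C_kF_k$, $J\omega_{k+1}=F_k^{T}J\omega_k+\frac h2F_k^{T}M_k+\frac h2M_{k+1}$, with $M_k=M(C_k)$. **The estimation algorithm.** Successive measurements are $l$ time steps apart. Given the filtered estimate $(\hat C_k,\hat\omega_k)$ with uncertainty matrix $P_0$ $(=P_k)$ at the previous measurement instant $k$, one cycle of the algorithm, producing the estimate at the current measurement instant $k+l$, is: 1. *Flow update.* $(\hat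 C^f,\hat\omega^f)$ is the image of $(\hat C_k,\hat\omega_k)$ under $l$ steps of the discrete flow. $A^f_j\in\mathbb{R}^{6\times6}$ is the matrix of the linearization of one step of the discrete flow along the predicted trajectory at step $j$, in the coordinates $x=[\zeta^{T},\delta\omega^{T}]^{T}$ in which a perturbed state is $(\hat C\exp(S(\zeta)),\hat\omega+\delta\omega)$. $A^f=A^f_{k+l-1}\cdots A^f_k$ and $P^f=A^fP_0(A^f)^{T}$. 2. *Measurement update.* There are $m\ge3$ known inertial unit vectors $e^1,\dots,e^m$, no two collinear; unit vectors $\tilde b^1,\dots,\tilde b^m$ (their noisy body-frame directions) and an angular velocity $\tilde\omega\in\mathbb{R}^3$ are measured. The measurement errors are bounded by ellipsoids with symmetric positive definite matrices $S^i$ (direction $i$) and $T$ (angular velocity) in $\mathbb{R}^{3\times3}$. With $E=[e^1,\dots,e^m]$, $\tilde B=[\tilde b^1,\dots,\tilde b^m]$, $W=\mathrm{diag}[w_1,\dots,w_m]$ (weights), $\tilde L=EW\tilde B^{T}$ (invertible), set $\hat C^m=Q_q\sqrt{(Q_rQ_r^{T})^{-1}}\,Q_q^{T}\tilde L$, where $\tilde L=Q_qQ_r$ with $Q_q\in SO(3)$, $Q_r$ upper triangular and invertible, and the square root is symmetric positive definite; set $\hat\omega^m=\tilde\omega$. With $\mathcal{A}^{i}=-\{\mathrm{tr}[(\hat C^m)^{T}\tilde L]I_{3\times3}-(\hat C^m)^{T}\tilde L\}^{-1}w_i\{\mathrm{tr}[\tilde b^i(e^i)^{T}\hat C^m]I_{3\times3}-\tilde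 b^i(e^i)^{T}\hat C^m\}$, $H_1=[I_{3\times3},0_{3\times3}]^{T}$, $H_2=[0_{3\times3},I_{3\times3}]^{T}$, $N_i=H_1\mathcal{A}^iS^i(\mathcal{A}^i)^{T}H_1^{T}$ for $1\le i\le m$ and $N_{m+1}=H_2TH_2^{T}$, set $$P^m=\Big\{\sum_{i=1}^{m+1}\sqrt{\mathrm{tr}[N_i]}\Big\}\Big\{\sum_{i=1}^{m+1}\frac{N_i}{\sqrt{\mathrm{tr}[N_i]}}\Big\}.$$ 3. *Filtering.* Let $\hat x^{mf}=[(\hat\zeta^{mf})^{T},(\delta\hat\omega^{mf})^{T}]^{T}\in\mathbb{R}^6$ where $\hat C^f=\hat C^m\exp(S(\hat\zeta^{mf}))$ and $\hat\omega^f=\hat\omega^m+\delta\hat\omega^{mf}$. For $q>0$ put $$L=P^m(P^m+q^{-1}P^f)^{-1},\quad \beta(q)=1+q-(\hat x^{mf})^{T}(P^m)^{-1}L\,\hat x^{mf},\quad \hat x=L\hat x^{mf},\quad P=\beta(q)(I-L)P^m,$$ with $q$ chosen so that $\mathrm{tr}[P]$ is minimized. Writing $\hat x=[\hat\zeta^{T},\delta\hat\omega^{T}]^{T}$, the new estimate is $\hat C_{k+l}=\hat C^m\exp(S(\hat\zeta))$, $\hat\omega_{k+l}=\hat\omega^m+\delta\hat\omega$, with new uncertainty matrix $P_{k+l}=P$. This $P$ is the $P_0$ of the next cycle. The quantities $A^f,P^f,P^m,q,\lambda_{\min}$ in general differ from one measurement to the next; the constant $c$ is the same for all measurements. *)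

(* Defs.v *)
From HB Require Import structures.
From mathcomp Require Import all_boot all_order all_algebra.
From mathcomp Require Import all_classical all_reals all_analysis.

Set Implicit Arguments.
Unset Strict Implicit.
Unset Printing Implicit Defensive.

Import Order.TTheory GRing.Theory Num.Theory.
Import numFieldNormedType.Exports.

Local Open Scope classical_set_scope.
Local Open Scope ring_scope.

(* Vectors are column vectors.  An element of R^6 is x = col_mx zeta domega,
   read back with [usubmx]/[dsubmx] at dimension 3 + 3. *)

Section LinearAlgebra.
Variable R : realType.
Implicit Types (n : nat).

Definition dotv n (x y : 'cV[R]_n) : R := (x^T *m y) 0 0.

Definition unitv n (x : 'cV[R]_n) : Prop := dotv x x = 1.

Definition spd n (A : 'M[R]_n) : Prop :=
  A^T = A /\ forall x : 'cV[R]_n, x != 0 -> 0 < dotv x (A *m x).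

Definition frobenius n (A : 'M[R]_n) : R :=
  Num.sqrt (\sum_i \sum_j A i j ^+ 2).

Definition eig_max n (A : 'M[R]_n) : R := sup [set a | eigenvalue A a].
Definition eig_min n (A : 'M[R]_n) : R := inf [set a | eigenvalue A a].

Definition cond_number n (A : 'M[R]_n) : R := eig_max A / eig_min A.

Definition chi (A : 'M[R]_6) : R := Num.sqrt (6 + 30 * cond_number A).

(* [lam] lists the eigenvalues of A with multiplicity. *)
Definition eigenvalues_of n (A : 'M[R]_n) (lam : 'I_n -> R) : Prop :=
  char_poly A = \prod_(i < n) ('X - (lam i)%:P).

Definition lambda_min (lam : 'I_6 -> R) : R :=
  \big[Num.min/lam ord0]_(i < 6) lam i.

Definition expm n (A : 'M[R]_n) : 'M[R]_n :=
  \matrix_(i, j) limn (series (fun k : nat => (A ^+ k) i j / k`!%:R)).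

Definition SO3 : set 'M[R]_3 := [set C | C^T *m C = 1%:M /\ \det C = 1].

Definition crossv (x y : 'cV[R]_3) : 'cV[R]_3 :=
  \col_(i < 3) [:: x 1 0 * y 2 0 - x 2 0 * y 1 0;
                   x 2 0 * y 0 0 - x 0 0 * y 2 0;
                   x 0 0 * y 1 0 - x 1 0 * y 0 0]`_i.

Definition skew (x : 'cV[R]_3) : 'M[R]_3 :=
  \matrix_(i, j) crossv x (delta_mx j 0) i 0.

Lemma sum3E (F : 'I_3 -> R) : \sum_i F i = F 0 + F 1 + F 2.
Proof.
rewrite !big_ord_recl big_ord0 addr0 addrA.
by congr (_ + F _ + F _); apply: val_inj.
Qed.

Lemma ord3P (i : 'I_3) : [\/ i = 0, i = 1 | i = 2].
Proof.
by case: i => [[|[|[|//]]] i3]; [apply: Or31 | apply: Or32 | apply: Or33];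
  apply: val_inj.
Qed.

Lemma skewE (x y : 'cV[R]_3) : skew x *m y = crossv x y.
Proof.
apply/colP => i; rewrite !mxE sum3E !mxE.
by case: (ord3P i) => -> /=;
  rewrite !(mulr0, mulr1, subr0, sub0r) ?mulNr !(mul0r, oppr0, add0r, addr0) //;
  rewrite addrC.
Qed.

(* Inverse of [skew] on skew-symmetric matrices. *)
Definition unskew (X : 'M[R]_3) : 'cV[R]_3 :=
  \col_(i < 3) [:: X 2 1; X 0 2; X 1 0]`_i.

Lemma unskewK (X : 'M[R]_3) : X^T = - X -> skew (unskew X) = X.
Proof.
move=> XT; have XTE i j : X i j = - X j i.
  by have /matrixP/(_ j i) := XT; rewrite !mxE.
have X0 i : X i i = 0.
  by apply/eqP; rewrite -eqNr -XTE.
apply/matrixP => i j; rewrite !mxE.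
by case: (ord3P i) => ->; case: (ord3P j) => -> /=;
  rewrite ?mxE /= !(mulr0, mulr1, subr0, sub0r, subrr) ?X0 ?oppr0 // -XTE.
Qed.

End LinearAlgebra.

Section Flow.
Variable R : realType.
Variables (J : 'M[R]_3) (h : R) (U : 'M[R]_3 -> R) (f : 'cV[R]_3 -> 'cV[R]_3).

Definition inertia_d : 'M[R]_3 := (2^-1 * \tr J)%:M - J.

(* The potential is differentiated as a function of the nine entries of C;
   on SO(3), [moment] depends only on the restriction of U to SO(3). *)
Definition grad (C : 'M[R]_3) : 'M[R]_3 :=
  \matrix_(i, j) derive (U : 'M[R]_3 -> R^o) C (delta_mx i j).

Definition moment (C : 'M[R]_3) : 'cV[R]_3 :=
  unskew ((grad C)^T *m C - C^T *m grad C).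

Lemma skew_moment (C : 'M[R]_3) :
  skew (moment C) = (grad C)^T *m C - C^T *m grad C.
Proof.
by apply: unskewK; rewrite linearB /= !trmx_mul !trmxK opprB.
Qed.

(* [f] is the solver of the implicit equation: F_k = exp(S(f_k)), where f_k is
   a function of J omega_k + h/2 M_k.  The equation need not be solvable for
   every right-hand side, so that f is only required to solve it at the points
   where the flow is used. *)
Definition flow_step (C : 'M[R]_3) (w : 'cV[R]_3)
    (C' : 'M[R]_3) (w' : 'cV[R]_3) : Prop :=
  let a := J *m w + (h / 2) *: moment C in
  let F := expm (skew (f a)) in
  [/\ h *: skew a = F *m inertia_d - inertia_d *m F^T,
      C' = C *m F &
      J *m w' = F^T *m (J *m w) + (h / 2) *: (F^T *m moment C)
                + (h / 2) *: moment C'].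

Definition perturb_att (C : 'M[R]_3) (x : 'cV[R]_6) : 'M[R]_3 :=
  C *m expm (skew (usubmx (x : 'cV[R]_(3 + 3)))).

Definition perturb_vel (w : 'cV[R]_3) (x : 'cV[R]_6) : 'cV[R]_3 :=
  w + dsubmx (x : 'cV[R]_(3 + 3)).

(* [g] is the one-step flow read in the perturbation coordinates centered at
   (C, w) and (C', w'). *)
Definition flow_linearization (C : 'M[R]_3) (w : 'cV[R]_3)
    (C' : 'M[R]_3) (w' : 'cV[R]_3) (A : 'M[R]_6) : Prop :=
  exists g : 'cV[R]_6 -> 'cV[R]_6,
    [/\ g 0 = 0,
        is_diff (0 : 'cV[R]_6) g (mulmx A) &
        \forall x \near (0 : 'cV[R]_6),
          flow_step (perturb_att C x) (perturb_vel w x)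
                    (perturb_att C' (g x)) (perturb_vel w' (g x))].

Definition flow_update (l : nat) (C : 'M[R]_3) (w : 'cV[R]_3)
    (Cf : 'M[R]_3) (wf : 'cV[R]_3) (Af : 'M[R]_6) : Prop :=
  exists (Cs : nat -> 'M[R]_3) (ws : nat -> 'cV[R]_3) (As : nat -> 'M[R]_6),
    [/\ Cs 0%N = C /\ ws 0%N = w,
        Cs l = Cf /\ ws l = wf,
        forall j, (j < l)%N ->
          flow_step (Cs j) (ws j) (Cs j.+1) (ws j.+1),
        forall j, (j < l)%N ->
          flow_linearization (Cs j) (ws j) (Cs j.+1) (ws j.+1) (As j) &
        Af = \prod_(j < l) As (rev_ord j)].

End Flow.

Section Measurement.
Variables (R : realType) (m : nat).

Record measurement := Measurement {
  weight : 'I_m -> R ;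
  dir : 'I_m -> 'cV[R]_3 ;
  angvel : 'cV[R]_3 ;
  dir_unc : 'I_m -> 'M[R]_3 ;
  angvel_unc : 'M[R]_3 }.

Variables (e : 'I_m -> 'cV[R]_3) (z : measurement).

Definition Lmx : 'M[R]_3 :=
  (\matrix_(i, j) e j i 0) *m diag_mx (\row_i weight z i)
  *m (\matrix_(i, j) dir z j i 0)^T.

(* Nonzero weights make all [tr N_i] below nonzero. *)
Definition valid_measurement : Prop :=
  [/\ forall i, weight z i != 0, forall i, unitv (dir z i),
      forall i, spd (dir_unc z i), spd (angvel_unc z) & Lmx \in unitmx].

Definition measured_att (Cm : 'M[R]_3) : Prop :=
  exists Qq Qr Q : 'M[R]_3,
    [/\ Lmx = Qq *m Qr, Qq \in @SO3 R,
        (forall i j : 'I_3, (j < i)%N -> Qr i j = 0) /\ Qr \in unitmx,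
        spd Q /\ Q *m Q = invmx (Qr *m Qr^T) &
        Cm = Qq *m Q *m Qq^T *m Lmx].

Variable Cm : 'M[R]_3.

Definition err_mx (i : 'I_m) : 'M[R]_3 :=
  let X := Cm^T *m Lmx in
  let Y := dir z i *m (e i)^T *m Cm in
  - (invmx ((\tr X)%:M - X) *m (weight z i *: ((\tr Y)%:M - Y))).

Definition H1 : 'M[R]_(6, 3) := col_mx (1%:M : 'M[R]_3) (0 : 'M[R]_3).
Definition H2 : 'M[R]_(6, 3) := col_mx (0 : 'M[R]_3) (1%:M : 'M[R]_3).

(* The last index carries the angular velocity term. *)
Definition Nmx (i : 'I_m.+1) : 'M[R]_6 :=
  if unlift ord_max i is Some j then
    H1 *m err_mx j *m dir_unc z j *m (err_mx j)^T *m H1^T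
  else H2 *m angvel_unc z *m H2^T.

Definition measured_unc : 'M[R]_6 :=
  (\sum_i Num.sqrt (\tr (Nmx i)))
    *: \sum_i ((Num.sqrt (\tr (Nmx i)))^-1 *: Nmx i).

End Measurement.

Section Filter.
Variable R : realType.
Variables (Pm Pf : 'M[R]_6) (x : 'cV[R]_6).

Definition gain (q : R) : 'M[R]_6 := Pm *m invmx (Pm + q^-1 *: Pf).

Definition beta (q : R) : R := 1 + q - dotv x (invmx Pm *m gain q *m x).

Definition filtered_unc (q : R) : 'M[R]_6 :=
  beta q *: ((1%:M - gain q) *m Pm).

Definition optimal_parameter (q : R) : Prop :=
  0 < q /\
  forall q', 0 < q' -> \tr (filtered_unc q) <= \tr (filtered_unc q').

End Filter.

Section Algorithm.
Variables (R : realType) (m : nat).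
Variables (J : 'M[R]_3) (h : R) (U : 'M[R]_3 -> R) (f : 'cV[R]_3 -> 'cV[R]_3).
Variables (l : nat) (e : 'I_m -> 'cV[R]_3).

Record estimate := Estimate {
  att : 'M[R]_3 ;
  vel : 'cV[R]_3 ;
  unc : 'M[R]_6 }.

Definition predicted_unc (Af P0 : 'M[R]_6) : 'M[R]_6 := Af *m P0 *m Af^T.

(* One cycle, from the estimate [s] to the estimate [s'] with measurement [z];
   [Af], [Pm] and [q] are the linear discrete flow matrix, the measured
   uncertainty matrix and the filter parameter of the cycle. *)
Definition estimation_cycle (z : measurement R m) (s s' : estimate)
    (Af Pm : 'M[R]_6) (q : R) : Prop :=
  exists (Cf Cm : 'M[R]_3) (wf : 'cV[R]_3) (xmf : 'cV[R]_6),
    let Pf := predicted_unc Af (unc s) in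
    let xhat := gain Pm Pf q *m xmf in
    [/\ flow_update J h U f l (att s) (vel s) Cf wf Af,
        measured_att e z Cm /\ Pm = measured_unc e z Cm,
        Cf = perturb_att Cm xmf /\ wf = perturb_vel (angvel z) xmf,
        optimal_parameter Pm Pf xmf q &
        s' = Estimate (perturb_att Cm xhat) (perturb_vel (angvel z) xhat)
                      (filtered_unc Pm Pf xmf q)].

End Algorithm.

(* Main.v *)
(** The matrix [(I - L) Pm] is [(Pm^-1 + q Pf^-1)^-1], and [beta q <= 1 + q].
    Since [Pf >= lambda_min Pm] as quadratic forms, [Pm^-1 >= lambda_min Pf^-1],
    so that [(I - L) Pm <= Pf / (q + lambda_min)] and
    [tr P <= (1 + q) / (q + lambda_min) * tr (Af P0 Af^T)].  Finally
    [tr (Af P0 Af^T) <= |Af|^2 tr P0] with the Frobenius norm, and the bound on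
    [|Af|] makes the resulting factor at most [c / (6 chi) < 1]. *)

Require Import Defs.
From HB Require Import structures.
From mathcomp Require Import all_boot all_order all_algebra.
From mathcomp Require Import all_classical all_reals all_analysis.
From mathcomp Require Import ring lra.

Set Implicit Arguments.
Unset Strict Implicit.
Unset Printing Implicit Defensive.

Import Order.TTheory GRing.Theory Num.Theory.
Import numFieldNormedType.Exports.

Local Open Scope classical_set_scope.
Local Open Scope ring_scope.

(** * Quadratic forms, trace bounds and generalized eigenvalues *)

Section QuadraticForms.
Variables (R : realType) (n : nat).
Implicit Types (A B P : 'M[R]_n) (x y : 'cV[R]_n).

Definition form A x y : R := dotv x (A *m y).

Lemma formDl A x y z : form A (x + y) z = form A x z + form A y z.
Proof. by rewrite /form /dotv linearD mulmxDl mxE. Qed.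

Lemma formDr A x y z : form A x (y + z) = form A x y + form A x z.
Proof. by rewrite /form /dotv !mulmxDr mxE. Qed.

Lemma formZl A a x y : form A (a *: x) y = a * form A x y.
Proof. by rewrite /form /dotv linearZ -scalemxAl mxE. Qed.

Lemma formZr A a x y : form A x (a *: y) = a * form A x y.
Proof. by rewrite /form /dotv -!scalemxAr mxE. Qed.

Lemma formBl A x y z : form A (x - y) z = form A x z - form A y z.
Proof. by rewrite formDl -scaleN1r formZl mulN1r. Qed.

Lemma formBr A x y z : form A x (y - z) = form A x y - form A x z.
Proof. by rewrite formDr -scaleN1r formZr mulN1r. Qed.

Lemma form_mxD A B x y : form (A + B) x y = form A x y + form B x y.
Proof. by rewrite /form /dotv mulmxDl mulmxDr mxE. Qed.

Lemma form_mxZ A a x y : form (a *: A) x y = a * form A x y.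
Proof. by rewrite /form /dotv -scalemxAl -scalemxAr mxE. Qed.

Lemma form_mxB A B x y : form (A - B) x y = form A x y - form B x y.
Proof. by rewrite form_mxD -scaleN1r form_mxZ mulN1r. Qed.

Lemma dotvC x y : dotv x y = dotv y x.
Proof. by rewrite /dotv !mxE; apply: eq_bigr => i _; rewrite !mxE mulrC. Qed.

Lemma formC A x y : A^T = A -> form A x y = form A y x.
Proof.
by move=> AT; rewrite /form dotvC /dotv trmx_mul AT -mulmxA.
Qed.

Lemma formE A x y : form A x y = \sum_i \sum_j x i 0 * A i j * y j 0.
Proof.
rewrite /form /dotv mxE; apply: eq_bigr => i _.
by rewrite !mxE big_distrr; apply: eq_bigr => j _; rewrite /= mulrA.
Qed.

Lemma form_delta A i j : form A (delta_mx i 0) (delta_mx j 0) = A i j.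
Proof.
by rewrite /form /dotv -colE trmx_delta -rowE !mxE.
Qed.

Lemma dotvE x : dotv x x = \sum_i x i 0 ^+ 2.
Proof. by rewrite /dotv mxE; apply: eq_bigr => i _; rewrite !mxE expr2. Qed.

Lemma dotv_ge0 x : 0 <= dotv x x.
Proof. by rewrite dotvE sumr_ge0 // => i _; exact: sqr_ge0. Qed.

Lemma dotv_gt0 x : x != 0 -> 0 < dotv x x.
Proof.
move=> x0; rewrite lt_def dotv_ge0 andbT; apply: contra x0 => /eqP.
rewrite dotvE => /psumr_eq0P xi0; apply/eqP/colP => i; rewrite mxE.
by apply/eqP; rewrite -sqrf_eq0 xi0 // => k _; exact: sqr_ge0.
Qed.

Definition psd A : Prop := A^T = A /\ forall x, 0 <= form A x x.

Lemma spd_psd A : spd A -> psd A.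
Proof.
move=> [AT Agt0]; split=> // x; have [->|x0] := eqVneq x 0.
  by rewrite /form /dotv !mulmx0 mxE.
exact: ltW (Agt0 x x0).
Qed.

Lemma spd_unitmx A : spd A -> A \in unitmx.
Proof.
move=> [AT Agt0]; rewrite unitmxE unitfE; apply/det0P => -[v v0 vA0].
have vT0 : v^T != 0 by rewrite trmx_eq0.
by have := Agt0 _ vT0; rewrite /dotv trmxK mulmxA vA0 mul0mx mxE ltxx.
Qed.

Lemma psd_trace_ge0 A : psd A -> 0 <= \tr A.
Proof.
by move=> [_ A0]; apply: sumr_ge0 => i _; rewrite -form_delta.
Qed.

Lemma spd_trace_gt0 A : (0 < n)%N -> spd A -> 0 < \tr A.
Proof.
move=> n0 sA; have [_ A0] := sA; have dA i : 0 < A i i.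
  rewrite -form_delta; apply: A0; apply/eqP => /colP/(_ i).
  by rewrite !mxE !eqxx /=; apply/eqP; exact: oner_neq0.
rewrite /mxtrace (bigD1 (Ordinal n0)) //= ltr_wpDr //.
by apply: sumr_ge0 => i _; exact: ltW.
Qed.

(* Sum over i, j the values of the form at x_j e_i - x_i e_j. *)
Lemma psd_form_le_trace A x : psd A -> form A x x <= \tr A * dotv x x.
Proof.
move=> [AT A0].
have Aij i j : 2 * (x i 0 * A i j * x j 0)
    <= x j 0 ^+ 2 * A i i + x i 0 ^+ 2 * A j j.
  have := A0 (x j 0 *: delta_mx i 0 - x i 0 *: delta_mx j 0).
  rewrite formBl !formBr !(formZl, formZr) !form_delta.
  have -> : A j i = A i j by rewrite -[in LHS]AT mxE.
  nra.
rewrite -(ler_pM2l (_ : 0 < 2)) // formE mulr_sumr.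
under eq_bigr do rewrite mulr_sumr.
apply: (le_trans (ler_sum _ (fun i _ => ler_sum _ (fun j _ => Aij i j)))).
under eq_bigr do rewrite big_split /= -mulr_suml -mulr_sumr.
rewrite big_split /= -mulr_sumr -mulr_suml -dotvE -/(\tr A).
lra.
Qed.

(** The form at [x - t *: y] is a nonnegative polynomial in [t] of degree at most two. Its leading
    coefficient may vanish even for [y != 0]. *)
Lemma psd_cauchy_schwarz A x y :
  psd A -> form A x y ^+ 2 <= form A x x * form A y y.
Proof.
move=> [AT A0].
have A0t t : 0 <= form A x x - 2 * t * form A x y + t ^+ 2 * form A y y.
  have := A0 (x - t *: y);
  rewrite formBl !formBr !(formZl, formZr) (formC y x) //.
  by move=> h; apply: le_trans h _; lra.
have := A0 x; have := A0 y; set a := form A x x; set b := form A x y.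
set c := form A y y; rewrite le_eqVlt => /predU1P[c0|c0] a0.
  (* With [c = 0] the polynomial is affine; for [b != 0] this [t] gives it the value -1. *)
  have := A0t ((a + 1) / (2 * b)); have [->|b0] := eqVneq b 0; first by nra.
  rewrite -/a -/b -/c -c0 mulr0 addr0.
  have -> : 2 * ((a + 1) / (2 * b)) * b = a + 1 by field.
  lra.
(* The minimizer of the polynomial. *)
have := A0t (b / c); rewrite -/a -/b -/c.
have -> : a - 2 * (b / c) * b + (b / c) ^+ 2 * c = (a * c - b ^+ 2) / c.
  by field; rewrite gt_eqF.
by rewrite pmulr_lge0 ?invr_gt0 // subr_ge0.
Qed.

Lemma psd_invmx A : psd A -> A \in unitmx -> psd (invmx A).
Proof.
move=> [AT A0] uA; split=> [|x]; first by rewrite trmx_inv AT.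
have := A0 (invmx A *m x).
by rewrite /form mulKVmx // dotvC.
Qed.

(* Cauchy-Schwarz for [A] at [x] and [invmx A *m x]. *)
Lemma psd_unit_coercive A : psd A -> A \in unitmx ->
  exists2 d : R, 0 < d & forall x, d * dotv x x <= form A x x.
Proof.
move=> pA uA; have pV := psd_invmx pA uA.
have tV := psd_trace_ge0 pV; have [_ A0] := pA.
(* Adding 1 makes the denominator positive from [0 <= \tr (invmx A)] alone. *)
exists (\tr (invmx A) + 1)^-1; first by rewrite invr_gt0; lra.
move=> x; have := psd_cauchy_schwarz x (invmx A *m x) pA.
have -> : form A x (invmx A *m x) = dotv x x by rewrite /form mulKVmx.
have -> : form A (invmx A *m x) (invmx A *m x) = form (invmx A) x x.
  by rewrite /form mulKVmx // dotvC.
have := psd_form_le_trace x pV; have := dotv_ge0 x; have := A0 x.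
set a := form A x x; set b := form (invmx A) x x; set t := \tr _ in tV *.
move=> a0; rewrite le_eqVlt => /predU1P[<- _ _|d0 hb hab].
  by rewrite mulr0.
rewrite mulrC ler_pdivrMr; last by lra.
rewrite -(ler_pM2r d0); nra.
Qed.

(* The largest [mu] with [B - mu *: A] positive semidefinite makes this matrix
   singular, so that it is a generalized eigenvalue. *)
Lemma psd_sub_eigenvalue A B t : (0 < n)%N -> spd A -> psd B ->
  (forall a, eigenvalue (invmx A *m B) a -> t <= a) -> psd (B - t *: A).
Proof.
move=> n0 sA pB tle; have pA := spd_psd sA.
have [AT A0] := pA; have [BT B0] := pB; have uA := spd_unitmx sA.
have sym a : (B - a *: A)^T = B - a *: A by rewrite linearB linearZ /= AT BT.
pose S := [set a | psd (B - a *: A)].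
have S0 : S 0 by rewrite /S /= scale0r subr0.
pose x0 : 'cV[R]_n := delta_mx (Ordinal n0) 0.
have Ax0 : 0 < form A x0 x0.
  apply: sA.2; apply/eqP => /colP/(_ (Ordinal n0)).
  by rewrite !mxE !eqxx /=; apply/eqP; exact: oner_neq0.
have supS : has_sup S.
  split; first by exists 0.
  exists (form B x0 x0 / form A x0 x0) => a [_ /(_ x0)].
  by rewrite form_mxB form_mxZ subr_ge0 ler_pdivlMr.
(* The supremum is attained: where the form of [A] is positive, each [a] in [S] is at most the
   quotient of the two forms, hence so is [sup S]. *)
have Smu : S (sup S).
  split=> // x; rewrite form_mxB form_mxZ subr_ge0.
  have [Axx|Axx] := eqVneq (form A x x) 0; first by rewrite Axx mulr0.
  rewrite -ler_pdivlMr; last by rewrite lt_def Axx A0.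
  apply: ge_sup; first by exists 0.
  move=> a [_ /(_ x)]; rewrite form_mxB form_mxZ subr_ge0 ler_pdivlMr //.
  by rewrite lt_def Axx A0.
have eig : eigenvalue (invmx A *m B) (sup S).
  (* If this matrix were invertible it would be coercive with some constant [d], and
     [sup S + d / \tr A] would still lie in [S]. *)
  have [uM|] := boolP (B - sup S *: A \in unitmx).
    have [d d0 dM] := psd_unit_coercive Smu uM.
    have trA := spd_trace_gt0 n0 sA.
    have : S (sup S + d / \tr A).
      split=> // x; have := dM x; have := psd_form_le_trace x pA.
      rewrite !(form_mxB, form_mxZ) mulrDl opprD addrA => hA hd.
      rewrite subr_ge0; apply: le_trans hd; rewrite -mulrA ler_pM2l //.
      by rewrite ler_pdivrMl.
    move=> /(ub_le_sup supS.2); rewrite gerDl leNgt divr_gt0 //.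
  rewrite unitmxE unitfE negbK => /det0P[v v0].
  rewrite mulmxBr => /eqP; rewrite subr_eq0 => /eqP vB.
  (* Eigenvectors are row vectors here: [v *m B = sup S *: (v *m A)] makes [v *m A] one for
     [invmx A *m B]. *)
  apply/eigenvalueP; exists (v *m A).
    by rewrite mulmxA mulmxK // vB -scalemxAr.
  by apply: contra v0 => /eqP vA; rewrite -(mulmxK uA v) vA mul0mx.
(* As [t <= sup S], [B - t *: A] is [B - sup S *: A] plus a nonnegative multiple of [A]. *)
split=> // x; have := Smu.2 x; rewrite !form_mxB !form_mxZ.
have := tle _ eig; have := A0 x; nra.
Qed.

Lemma spd_eigenvalue_gt0 A a : spd A -> eigenvalue A a -> 0 < a.
Proof.
move=> [AT A0] /eigenvalueP[v vA v0].
have vT0 : v^T != 0 by rewrite trmx_eq0.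
have := A0 _ vT0; rewrite /dotv trmxK mulmxA vA -scalemxAl mxE.
have -> : (v *m v^T) 0 0 = dotv v^T v^T by rewrite /dotv trmxK.
by rewrite pmulr_lgt0 // dotv_gt0.
Qed.

Lemma cond_number_ge0 A : spd A -> 0 <= cond_number A.
Proof.
move=> sA; rewrite /cond_number /eig_max /eig_min.
set S := [set a | _]; have S0 a : S a -> 0 <= a.
  by move=> Sa; apply: ltW; apply: spd_eigenvalue_gt0 sA Sa.
(* [sup] is 0 by default on an empty set, and below on one without upper bound. *)
have [->|/set0P Sn] := eqVneq S set0; first by rewrite sup0 mul0r.
apply: divr_ge0; last exact: lb_le_inf.
have [supS|/sup_out->//] := pselect (has_sup S).
by case: Sn => a Sa; apply: le_trans (S0 _ Sa) _; apply: ub_le_sup supS.2 _ Sa.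
Qed.

(** The [i]-th diagonal entry on the left is the form of [P] at row [i] of [A], and the squared
    norms of the rows add up to the squared Frobenius norm. *)
Lemma trace_congr_le A P : psd P ->
  \tr (A *m P *m A^T) <= frobenius A ^+ 2 * \tr P.
Proof.
move=> pP; rewrite sqr_sqrtr; last first.
  by do 2!(apply: sumr_ge0 => ? _); exact: sqr_ge0.
rewrite mulr_suml; apply: ler_sum => i _.
have := psd_form_le_trace (row i A)^T pP; rewrite mulrC.
have -> : form P (row i A)^T (row i A)^T = (A *m P *m A^T) i i.
  rewrite /form /dotv trmxK mulmxA -row_mul !mxE.
  by apply: eq_bigr => j _; rewrite !mxE.
congr (_ <= _ * _).
by rewrite dotvE; apply: eq_bigr => j _; rewrite !mxE.
Qed.

End QuadraticForms.

(** * Bounds on the filtered uncertainty matrix *)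

Section Filter.
Variable R : realType.
Implicit Types (x v : 'cV[R]_6) (t : R).

Section Fixed.
Variables (Pm Pf : 'M[R]_6) (q : R).
Hypotheses (sPm : spd Pm) (sPf : spd Pf) (q0 : 0 < q).

Lemma spd_innovation : spd (Pm + q^-1 *: Pf).
Proof.
have [[mT m0] [fT f0]] := (sPm, sPf); split=> [|x x0].
  by rewrite linearD linearZ /= mT fT.
rewrite -/(form _ x x) form_mxD form_mxZ.
by rewrite addr_gt0 ?m0 // mulr_gt0 ?f0 // invr_gt0.
Qed.

(** The subtracted term is the form of the inverse of [Pm + q^-1 *: Pf], a positive definite
    matrix. *)
Lemma beta_le x : beta Pm Pf x q <= 1 + q.
Proof.
rewrite /beta /gain mulKmx ?spd_unitmx // gerBl.
have sG := spd_innovation.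
exact: (psd_invmx (spd_psd sG) (spd_unitmx sG)).2.
Qed.

(* Put [y = (Pm + q^-1 Pf)^-1 Pm v] and [w = v - y], so that
   [Pm w = q^-1 Pf y = (I - L) Pm v]. *)
Lemma filtered_form_split v : exists w y : 'cV[R]_6,
  [/\ v = w + y, Pm *m w = q^-1 *: (Pf *m y) &
      form ((1%:M - gain Pm Pf q) *m Pm) v v =
      form Pm w w + q^-1 * form Pf y y].
Proof.
have uG := spd_unitmx spd_innovation.
pose y := invmx (Pm + q^-1 *: Pf) *m (Pm *m v); exists (v - y), y.
have Pw : Pm *m (v - y) = q^-1 *: (Pf *m y).
  have : (Pm + q^-1 *: Pf) *m y = Pm *m v by rewrite mulKVmx.
  by rewrite mulmxBr => <-; rewrite mulmxDl scalemxAl addrC addKr.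
split=> //; first by rewrite subrK.
have -> : form ((1%:M - gain Pm Pf q) *m Pm) v v = form Pm v (v - y).
  rewrite /form; congr (dotv _ _).
  by rewrite mulmxBl mul1mx mulmxBl mulmxBr /gain -!mulmxA.
rewrite -[in LHS](subrK y v) -{3}(subrK y v) addrK formDl; congr (_ + _).
by rewrite /form Pw /dotv -scalemxAr mxE.
Qed.

Lemma filtered_form_ge0 v : 0 <= form ((1%:M - gain Pm Pf q) *m Pm) v v.
Proof.
have [w [y [_ _ ->]]] := filtered_form_split v.
rewrite addr_ge0 ?mulr_ge0 ?invr_ge0 ?(ltW q0) //.
  exact: (spd_psd sPm).2.
exact: (spd_psd sPf).2.
Qed.

(** Under the splitting [v = w + y] the cross term [form Pf w y] is [q * form Pm w w]; the claim
    then reduces to [ptw] and [key]. *)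
Lemma filtered_form_le t v : 0 < q + t -> psd (Pf - t *: Pm) ->
  form ((1%:M - gain Pm Pf q) *m Pm) v v <= (q + t)^-1 * form Pf v v.
Proof.
move=> qt0 [_ pt]; have [w [y [-> Pw ->]]] := filtered_form_split v.
have [[mT m0] [fT f0]] := (spd_psd sPm, spd_psd sPf).
have PwE u : form Pm u w = q^-1 * form Pf u y.
  by rewrite /form Pw /dotv -scalemxAr mxE.
have Fwy : form Pf w y = q * form Pm w w by rewrite PwE mulVKf ?lt0r_neq0.
rewrite formDl !formDr (formC y w fT) Fwy ler_pdivlMl //.
have ptw : t * form Pm w w <= form Pf w w.
  by have := pt w; rewrite form_mxB form_mxZ subr_ge0.
have pty : t * form Pm y y <= form Pf y y.
  by have := pt y; rewrite form_mxB form_mxZ subr_ge0.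
(* This is the reversed order of the inverses, [t *: invmx Pf <= invmx Pm], at the common vector
   [Pm *m w = q^-1 *: (Pf *m y)]. *)
have key : t * (q^-1 ^+ 2 * form Pf y y) <= form Pm w w.
  have [t0|t0] := leP t 0.
    apply: le_trans (m0 w); rewrite mulr_le0_ge0 // mulr_ge0 // sqr_ge0 //.
  (* Expanding this square gives the cross term [- 2 * t * q^-1 ^+ 2 * form Pf y y]; by [pty] the
     last term returns at most half of it. *)
  have := m0 (w - (t * q^-1) *: y).
  rewrite formBl !formBr !(formZl, formZr) (formC w y mT) (PwE y).
  have : t * q^-1 ^+ 2 * (t * form Pm y y) <= t * q^-1 ^+ 2 * form Pf y y.
    by rewrite ler_wpM2l // mulr_ge0 ?ltW // exprn_gt0 // invr_gt0.
  lra.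
have qi : q * q^-1 = 1 by rewrite divff // lt0r_neq0.
have : q * (t * (q^-1 ^+ 2 * form Pf y y)) <= q * form Pm w w.
  by rewrite ler_pM2l.
have -> : q * (t * (q^-1 ^+ 2 * form Pf y y)) = t * q^-1 * form Pf y y.
  by rewrite -[RHS]mul1r -qi; ring.
have -> : (q + t) * (form Pm w w + q^-1 * form Pf y y) =
    (q + t) * form Pm w w + (q * q^-1) * form Pf y y + t * q^-1 * form Pf y y.
  by ring.
rewrite qi; lra.
Qed.

Lemma filtered_trace_le t x : 0 < q + t -> psd (Pf - t *: Pm) ->
  \tr (filtered_unc Pm Pf x q) <= (1 + q) / (q + t) * \tr Pf.
Proof.
move=> qt0 pt; rewrite /filtered_unc mxtraceZ.
(* The sign of the trace allows [beta] to be replaced by its upper bound [1 + q]. *)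
set X := _ *m Pm; have X0 : 0 <= \tr X.
  by apply: sumr_ge0 => i _; rewrite -form_delta filtered_form_ge0.
apply: le_trans (ler_wpM2r X0 (beta_le x)) _.
rewrite -mulrA ler_wpM2l //; first by have := q0; lra.
rewrite /mxtrace mulr_sumr; apply: ler_sum => i _.
by rewrite -!form_delta filtered_form_le.
Qed.

End Fixed.

Lemma chi_ge1 (Pm : 'M[R]_6) : spd Pm -> 1 <= chi Pm.
Proof.
move=> sPm; rewrite -sqrtr1 ler_sqrt; have := cond_number_ge0 sPm; lra.
Qed.

(** An eigenvalue is a root of the split characteristic polynomial, hence some [lam i]. *)
Lemma eigenvalues_of_lambda_min (A : 'M[R]_6) (lam : 'I_6 -> R) a :
  eigenvalues_of A lam -> eigenvalue A a -> lambda_min lam <= a.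
Proof.
move=> Alam; rewrite eigenvalue_root_char Alam => /rootP.
rewrite horner_prod => /eqP/prodf_eq0[i _].
rewrite hornerXsubC subr_eq0 => /eqP ->; exact: bigmin_le.
Qed.

End Filter.

Theorem theorem3p1 (R : realType)
    (J : 'M[R]_3) (h : R) (U : 'M[R]_3 -> R) (f : 'cV[R]_3 -> 'cV[R]_3)
    (l m : nat) (e : 'I_m -> 'cV[R]_3)
    (z : nat -> measurement R m) (s : nat -> estimate R)
    (Af Pm : nat -> 'M[R]_6) (q : nat -> R) (lam : nat -> 'I_6 -> R) :
  spd J -> 0 < h ->
  (forall C, C \in @SO3 R -> differentiable (U : 'M[R]_3 -> R^o) C) ->
  (0 < l)%N -> (3 <= m)%N ->
  (forall i, unitv (e i)) ->
  (forall i j, i != j -> forall a : R, e i != a *: e j) ->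
  (forall n, valid_measurement e (z n)) ->
  att (s 0%N) \in @SO3 R ->
  (forall n, estimation_cycle J h U f l e (z n) (s n) (s n.+1)
                              (Af n) (Pm n) (q n)) ->
  (forall n, spd (unc (s n))) ->
  (forall n, spd (predicted_unc (Af n) (unc (s n)))) ->
  (forall n, spd (Pm n)) ->
  (forall n, eigenvalues_of
     (invmx (Pm n) *m predicted_unc (Af n) (unc (s n))) (lam n)) ->
  (exists c : R, 0 < c < 1 /\
     forall n, frobenius (Af n)
       < Num.sqrt (c * (q n + lambda_min (lam n))
                   / (6 * chi (Pm n) * (1 + q n)))) ->
  forall n, \tr (unc (s n.+1)) < \tr (unc (s n)).
Proof.

move=> _ _ _ _ _ _ _ _ _ cyc sP0 sPf sPm lamE [c [/andP[c0 c1] bound]] n.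
have [Cf [Cm [wf [x [_ _ _ [q0 _] snE]]]]] := cyc n; rewrite {}snE /=.
have := bound n; have sM := sPm n; have sF := sPf n; have chi1 := chi_ge1 sM.
set P0 := unc (s n) in sF *; set t := lambda_min _.
set Pf := predicted_unc _ _ in sF *; set K := frobenius _ => Kbound.
have trP0 : 0 < \tr P0 by apply: spd_trace_gt0 => //; exact: sP0.
have K0 : 0 <= K by exact: sqrtr_ge0.
have D0 : 0 < 6 * chi (Pm n) * (1 + q n).
  by rewrite !mulr_gt0 //; move: chi1 q0; lra.
(* [Num.sqrt] vanishes on nonpositive reals, so a strict bound on [K >= 0] forces a positive
   radicand, and with it [0 < q n + t]. *)
have r0 : 0 < c * (q n + t) / (6 * chi (Pm n) * (1 + q n)).
  by rewrite -sqrtr_gt0; apply: le_lt_trans K0 Kbound.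
have qt0 : 0 < q n + t by move: r0; rewrite pmulr_lgt0 ?invr_gt0 // pmulr_rgt0.
have K2 : K ^+ 2 * (6 * chi (Pm n) * (1 + q n)) < c * (q n + t).
  rewrite -ltr_pdivlMr // -[ltRHS]sqr_sqrtr ?(ltW r0) //.
  by rewrite ltr_pXn2r ?nnegrE // sqrtr_ge0.
have pt : psd (Pf - t *: Pm n).
  apply: psd_sub_eigenvalue => //; first exact: spd_psd.
  by move=> a; apply: eigenvalues_of_lambda_min (lamE n).
apply: le_lt_trans (filtered_trace_le sM sF q0 x qt0 pt) _.
have trPf : \tr Pf <= K ^+ 2 * \tr P0.
  exact: trace_congr_le (spd_psd (sP0 n)).
rewrite mulrAC ltr_pdivrMr //.
have : (1 + q n) * \tr Pf <= (1 + q n) * (K ^+ 2 * \tr P0).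
  by rewrite ler_wpM2l //; lra.
(* After cancelling [\tr P0 > 0], it remains to see [K ^+ 2 * (1 + q n) < q n + t], from [K2] with
   [6 * chi (Pm n) >= 1] and [c < 1]. *)
move=> /le_lt_trans; apply; rewrite mulrA mulrC ltr_pM2l //.
have : K ^+ 2 * (1 + q n) <= K ^+ 2 * (6 * chi (Pm n) * (1 + q n)).
  by rewrite ler_wpM2l ?sqr_ge0 // ler_peMl //; lra.
have : c * (q n + t) < q n + t by rewrite gtr_pMl.
lra.
Qed.
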